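(* Let $\bar\sigma=1/\cos\bar\alpha$, where $\bar\alpha\in(0,\pi/2)$ is the unique solution of $(2\pi+\bar\alpha)\cot\bar\alpha-\ln\frac{2\pi+\bar\alpha}{\sin\bar\alpha}=1$. Let $1<\sigma\le\bar\sigma$ and let $Z_{\mathrm{sat}}$ be the saturated spiral for the construction speed $\sigma$. Then $Z_{\mathrm{sat}}$ does not confine the fire, i.e. $r_{\mathrm{sat}}(\phi)>0$ for every $\phi\ge0$.
   Context: The fire initially occupies $R_0=B_1(0)\subset\mathbb R^2$ and spreads with unit speed in all directions; a barrier $Z$ is built with construction speed $\sigma$. $R^Z(t)$ is the set of points reachable at time $t$ from $R_0$ by curves of speed at most $1$ not crossing $Z$. The saturated spiral $Z_{\mathrm{sat}}$ is the spiral barrier starting from $(1,0)$ and turning counterclockwise for which all the available barrier is used at every time: $\mathcal H^1(Z_{\mathrm{sat}}\cap\overline{R^{Z_{\mathrm{sat}}}(t)})=\sigma t$ for all $t$. Put $\alpha=\arccos(1/\sigma)\in(0,\pi/2)$; the fire rays form the constant angle $\alpha$ with the spiral. Let $r_{\mathrm{sat}}(\phi)$ be the length of the last segment of the fire ray reaching the spiral, where $\phi$ is the rotation angle of that segment. Then $r_{\mathrm{sat}}$ is the solution of $$\frac{d}{d\phi}r_{\mathrm{sat}}(\phi)=\cot(\alpha)\,r_{\mathrm{sat}}(\phi)-\frac{r_{\mathrm{sat}}(\phi-(2\pi+\alpha))}{\sin\alpha},\qquad \phi\ge 2\pi+\alpha,$$ with initial data $r_{\mathrm{sat}}(\phi)=e^{\cot(\alpha)\phi}$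 for $\phi\in[0,2\pi)$ and $r_{\mathrm{sat}}(\phi)=(e^{2\pi\cot\alpha}-1)e^{\cot(\alpha)(\phi-2\pi)}$ for $\phi\in[2\pi,2\pi+\alpha]$. The spiral confines the fire iff $r_{\mathrm{sat}}$ vanishes at some angle (the spiral closes into itself). *)

(* Defs.v *)
From Stdlib Require Import Reals.
From Coquelicot Require Import Coquelicot.
Open Scope R_scope.

Definition cot (x : R) : R := cos x / sin x.

Definition is_critical_angle (a : R) : Prop :=
  0 < a < PI / 2 /\
  (2 * PI + a) * cot a - ln ((2 * PI + a) / sin a) = 1.

Definition is_right_derive (f : R -> R) (x l : R) : Prop :=
  filterlim (fun h => (f (x + h) - f x) / h) (at_right 0) (locally l).

(* [r phi] is the length of the last segment, of direction [phi], of the fire ray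
   reaching the saturated spiral, [alpha] being the constant angle between the
   fire rays and the spiral.  The spiral closes into itself, thereby confining
   the fire, exactly when [r] vanishes at some angle.

   [r] is only constrained on [0, +oo).  The initial datum jumps at 2 PI, so
   the delayed term jumps at 4 PI + alpha, and the datum and the equation
   prescribe different slopes on the two sides of 2 PI + alpha: at these two
   angles the solution has a kink.  Hence a solution is a continuous function
   satisfying the equation at every angle with the right derivative; elsewhere
   the right-hand side is continuous and this is the ordinary derivative. *)
Record is_r_sat (alpha : R) (r : R -> R) : Prop := {
  r_sat_init1 : forall phi, 0 <= phi < 2 * PI ->
    r phi = exp (cot alpha * phi);
  r_sat_init2 : forall phi, 2 * PI <= phi <= 2 * PI + alpha ->
    r phi = (exp (2 * PI * cot alpha) - 1) * exp (cot alpha * (phi - 2 * PI));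
  r_sat_continuous : forall phi, 2 * PI + alpha <= phi -> continuous r phi;
  r_sat_equation : forall phi, 2 * PI + alpha <= phi ->
    is_right_derive r phi
      (cot alpha * r phi - r (phi - (2 * PI + alpha)) / sin alpha)
}.

(* Main.v *)
Require Import Defs.
From Stdlib Require Import Reals Ranalysis5 Lra.
From Coquelicot Require Import Coquelicot.
Open Scope R_scope.

(** Write [T = 2 PI + alpha] for the delay and [c = cot alpha].  The weighted
    function [w phi = r phi * exp ((1 / T - c) * phi)] satisfies
    [w' phi = k * w phi - beta * w (phi - T)] with [k = 1 / T] and
    [beta = exp (1 - c * T) / sin alpha].  Among all exponential weights, this
    one leaves the most room for [beta <= k], and for it [beta <= k] says
    exactly that [T * c - ln (T / sin alpha) >= 1].  The left-hand side,
    [critical_fun], is strictly decreasing on [(0, PI / 2]] and crosses [1]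
    between [PI / 4] and [PI / 2]; this gives the unique critical angle, and
    [beta <= k] for all smaller angles, that is, for all construction speeds up
    to the critical one.

    When [beta <= k], positivity propagates.  If [0 < w <= w A] on [[0, A]],
    then on the next interval of length [T] the delayed term is at most
    [k * w A], so that [w] cannot fall below [w A]
    (multiply [w - w A] by [exp (- k * phi)]); therefore [w' >= 0] there and [w]
    attains its maximum over [[0, A + T]] at the right end ([delay_step]).

    It remains to start the induction: [w <= w T] on [[0, T]].  The jump of
    the datum at [2 PI] multiplies [w] by [1 - exp (- 2 PI c)], and between
    [2 PI] and [T] it grows again by [exp (alpha / T)]; the growth outweighs the
    loss ([initial_jump_bound]) because [exp (2 PI c)] is at least
    [2 + 2 PI / alpha].  For [alpha <= PI / 4] this holds as [cot alpha] is close
    to [1 / alpha]; for larger angles it follows from the criticality bound. *)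

(** * Right derivatives and monotonicity *)

Lemma continuous_of_ex_derive (f : R -> R) (x : R) : ex_derive f x -> continuous f x.
Proof. exact (@ex_derive_continuous R_AbsRing R_NormedModule f x). Qed.

Lemma right_derive_increment_ge (f : R -> R) (x l : R) :
  is_right_derive f x l ->
  forall eps, 0 < eps -> exists delta, 0 < delta /\
    forall h, 0 < h < delta -> (l - eps) * h <= f (x + h) - f x.
Proof.
  intros Hf eps Heps.
  destruct (Hf (ball l eps) (locally_ball l (mkposreal eps Heps))) as [d Hd].
  exists d; split; [apply cond_pos |]. intros h Hh.
  assert (B : ball l eps ((f (x + h) - f x) / h)).
  { apply Hd; [| lra].
    change (Rabs (h - 0) < d). rewrite Rabs_pos_eq; lra. }
  change (Rabs ((f (x + h) - f x) / h - l) < eps) in B.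
  apply Rabs_def2 in B. destruct B as [_ B].
  replace (f (x + h) - f x) with ((f (x + h) - f x) / h * h) by (field; lra).
  apply Rmult_le_compat_r; lra.
Qed.

Lemma is_right_derive_of_is_derive (g : R -> R) (x m : R) :
  is_derive g x m -> is_right_derive g x m.
Proof.
  intros Hg P [eps HP]. apply is_derive_Reals in Hg.
  destruct (Hg eps (cond_pos eps)) as [d Hd].
  exists d. intros h Bh Hh. apply HP. apply Hd; [lra |].
  change (Rabs (h - 0) < d) in Bh. now rewrite Rminus_0_r in Bh.
Qed.

Lemma is_right_derive_minus_const (f : R -> R) (x l M : R) :
  is_right_derive f x l -> is_right_derive (fun y => f y - M) x l.
Proof.
  unfold is_right_derive. apply filterlim_ext. intros h. f_equal; ring.
Qed.

Lemma is_right_derive_mult (f g : R -> R) (x l m : R) :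
  is_right_derive f x l -> is_derive g x m ->
  is_right_derive (fun y => f y * g y) x (l * g x + f x * m).
Proof.
  intros Hf Hg.
  assert (Cg : filterlim (fun h => g (x + h)) (at_right 0) (locally (g x))).
  { assert (C : continuous (fun h => g (x + h)) 0).
    { apply (continuous_comp (fun h => x + h) g).
      - apply (continuous_plus (fun _ => x) (fun h => h));
          [apply continuous_const | apply continuous_id].
      - rewrite Rplus_0_r. apply continuous_of_ex_derive. now exists m. }
    unfold continuous in C. rewrite Rplus_0_r in C.
    exact (filterlim_filter_le_1 _ (filter_le_within (F := locally 0) _) C). }
  pose proof (is_right_derive_of_is_derive _ _ _ Hg) as Hg'.
  assert (L : filterlim
    (fun h => plus (mult ((f (x + h) - f x) / h) (g (x + h)))
                   (mult (f x) ((g (x + h) - g x) / h)))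
    (at_right 0) (locally (plus (mult l (g x)) (mult (f x) m)))).
  { eapply filterlim_comp_2; [| | apply (@filterlim_plus R_AbsRing R_NormedModule)].
    - eapply filterlim_comp_2; [exact Hf | exact Cg | apply (@filterlim_mult R_AbsRing)].
    - eapply filterlim_comp_2;
        [apply filterlim_const | exact Hg' | apply (@filterlim_mult R_AbsRing)]. }
  unfold is_right_derive. eapply filterlim_ext_loc; [| exact L].
  exists (mkposreal 1 Rlt_0_1). intros h _ Hh.
  unfold plus, mult; simpl. field. lra.
Qed.

(** The largest point up to which [f] stays above the line of slope [- eps]
    through [(a, f a)] must be [b]: continuity keeps the inequality at that
    point, and the right derivative there would carry it further. *)
Lemma nondecreasing_of_right_derive (f : R -> R) (a b : R) :
  a <= b ->
  (forall x, a <= x <= b -> continuous f x) ->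
  (forall x, a <= x < b -> exists l, 0 <= l /\ is_right_derive f x l) ->
  f a <= f b.
Proof.
  intros Hab Hc Hd.
  assert (H : forall eps, 0 < eps -> f a - eps * (b - a) <= f b).
  { intros eps Heps.
    set (E := fun x => a <= x <= b /\ f a - eps * (x - a) <= f x).
    destruct (completeness E) as [s [Hub Hlub]].
    { exists b. intros x [Hx _]. lra. }
    { exists a. split; lra. }
    assert (Has : a <= s). { apply Hub. split; lra. }
    assert (Hsb : s <= b). { apply Hlub. intros x [Hx _]. lra. }
    assert (Es : E s).
    { split; [lra |].
      apply Rnot_lt_le. intros Hlt.
      (* The inequality would fail on a left neighbourhood of [s], which then
         contains a smaller upper bound of [E]. *)
      set (e := f a - eps * (s - a) - f s) in *.
      assert (He : 0 < e) by (unfold e; lra).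
      destruct (Hc s (conj Has Hsb) (ball (f s) e)
                  (locally_ball (f s) (mkposreal e He))) as [d Hdl].
      assert (Hs : s <= s - d).
      { apply Hlub. intros x Ex. apply Rnot_lt_le. intros Hx.
        assert (Hxs : x <= s) by now apply Hub.
        destruct Ex as [Hxab Hfx].
        assert (B : ball (f s) e (f x)).
        { apply Hdl. change (Rabs (x - s) < d). apply Rabs_def1; lra. }
        change (Rabs (f x - f s) < e) in B. apply Rabs_def2 in B.
        assert (eps * (x - a) <= eps * (s - a)) by (apply Rmult_le_compat_l; lra).
        unfold e in B. lra. }
      pose proof (cond_pos d). lra. }
    destruct (Rle_lt_or_eq_dec s b Hsb) as [Hlt | Heq].
    2: { rewrite <- Heq. apply Es. }
    exfalso.
    destruct (Hd s (conj Has Hlt)) as [l [Hl Hder]].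
    destruct (right_derive_increment_ge _ _ _ Hder eps Heps) as [d [Hd0 Hstep]].
    set (h := Rmin (d / 2) (b - s)).
    assert (Hh : 0 < h <= b - s /\ h < d).
    { unfold h. generalize (Rmin_l (d / 2) (b - s)) (Rmin_r (d / 2) (b - s)).
      assert (0 < Rmin (d / 2) (b - s)) by (apply Rmin_glb_lt; lra). lra. }
    assert (s + h <= s); [| lra].
    apply Hub. split; [lra |].
    destruct Es as [_ Es]. specialize (Hstep h ltac:(lra)).
    assert (0 <= l * h) by (apply Rmult_le_pos; lra). lra. }
  (* A slope for which the line loses only half of the supposed decrease. *)
  apply Rnot_lt_le. intros Hlt.
  assert (Hab' : a < b). { destruct Hab as [|<-]; lra. }
  specialize (H ((f a - f b) / (2 * (b - a)))).
  assert (P : 0 < (f a - f b) / (2 * (b - a))) by (apply Rdiv_lt_0_compat; lra).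
  specialize (H P).
  replace ((f a - f b) / (2 * (b - a)) * (b - a)) with ((f a - f b) / 2) in H
    by (field; lra).
  lra.
Qed.

(** * Positivity for the linear delay equation *)

(** The property that the present value dominates the whole past passes to the
    next interval of length [T].  The end value [w A] of the past is first shown
    to be a lower bound on that interval; this makes the slope nonnegative
    there, since the delayed term only sees the past. *)
Lemma delay_step (T k beta : R) (w : R -> R) (A : R) :
  0 < T -> 0 <= beta <= k ->
  (forall x, T <= x -> continuous w x) ->
  (forall x, T <= x -> is_right_derive w x (k * w x - beta * w (x - T))) ->
  T <= A ->
  (forall x, 0 <= x <= A -> 0 < w x <= w A) ->
  forall x, 0 <= x <= A + T -> 0 < w x <= w (A + T).
Proof.
  intros T_pos Hbeta w_continuous w_equation HA Hw.
  assert (wA : 0 < w A) by (apply Hw; lra).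
  assert (Past : forall x, A <= x <= A + T ->
    beta * w (x - T) <= k * w A).
  { intros x Hx. destruct (Hw (x - T)) as [H1 H2]; [lra |].
    apply Rmult_le_compat; lra. }
  (* [(w - w A) * exp (- k * x)] vanishes at [A] and has the nonnegative
     derivative [(k * w A - beta * w (x - T)) * exp (- k * x)]. *)
  assert (Above : forall x, A <= x <= A + T -> w A <= w x).
  { intros x Hx.
    assert (H : (w A - w A) * exp (- k * A) <= (w x - w A) * exp (- k * x)).
    { apply (nondecreasing_of_right_derive (fun y => (w y - w A) * exp (- k * y)));
        [lra | |]; intros y Hy.
      - apply (continuous_mult (fun y => w y - w A) (fun y => exp (- k * y))).
        + apply (continuous_minus w (fun _ => w A));
            [apply w_continuous; lra | apply continuous_const].
        + apply continuous_of_ex_derive. auto_derive. trivial.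
      - exists ((k * w y - beta * w (y - T)) * exp (- k * y)
                + (w y - w A) * (- k * exp (- k * y))).
        split.
        + replace (_ + _) with ((k * w A - beta * w (y - T)) * exp (- k * y)) by ring.
          apply Rmult_le_pos; [| left; apply exp_pos].
          specialize (Past y ltac:(lra)). lra.
        + apply (is_right_derive_mult (fun y => w y - w A) (fun y => exp (- k * y))).
          * apply is_right_derive_minus_const, w_equation. lra.
          * auto_derive; [trivial | ring]. }
    pose proof (exp_pos (- k * x)) as Hexp.
    apply Rnot_lt_le. intros Hlt.
    assert (0 < (w A - w x) * exp (- k * x)) by (apply Rmult_lt_0_compat; lra).
    lra. }
  assert (Mono : forall x, A <= x <= A + T -> w x <= w (A + T)).
  { intros x Hx. apply nondecreasing_of_right_derive; [lra | |]; intros y Hy.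
    - apply w_continuous. lra.
    - exists (k * w y - beta * w (y - T)). split; [| apply w_equation; lra].
      specialize (Past y ltac:(lra)). specialize (Above y ltac:(lra)).
      assert (k * w A <= k * w y) by (apply Rmult_le_compat_l; lra). lra. }
  intros x Hx. destruct (Rle_lt_dec x A) as [HxA | HxA].
  - specialize (Hw x ltac:(lra)). specialize (Mono A ltac:(lra)). lra.
  - specialize (Above x ltac:(lra)). specialize (Mono x ltac:(lra)). lra.
Qed.

Lemma delay_positive (T k beta : R) (w : R -> R) :
  0 < T -> 0 <= beta <= k ->
  (forall x, T <= x -> continuous w x) ->
  (forall x, T <= x -> is_right_derive w x (k * w x - beta * w (x - T))) ->
  (forall x, 0 <= x <= T -> 0 < w x <= w T) ->
  forall x, 0 <= x -> 0 < w x.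
Proof.
  intros T_pos Hbeta w_continuous w_equation Hinit.
  assert (H : forall n x, 0 <= x <= T + INR n * T -> 0 < w x <= w (T + INR n * T)).
  { induction n as [| n IH].
    - simpl (INR 0). rewrite Rmult_0_l, Rplus_0_r. exact Hinit.
    - rewrite S_INR. replace (T + (INR n + 1) * T) with (T + INR n * T + T) by ring.
      apply (delay_step T k beta); trivial.
      assert (0 <= INR n * T) by (apply Rmult_le_pos; [apply pos_INR | lra]). lra. }
  intros x Hx. destruct (nfloor_ex (x / T)) as [n Hn].
  { apply Rdiv_le_0_compat; lra. }
  apply (H n). split; [lra |].
  replace (T + INR n * T) with ((INR n + 1) * T) by ring.
  apply Rle_trans with (x / T * T); [right; field; lra |].
  apply Rmult_le_compat_r; lra.
Qed.

(** * The critical angle *)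

Definition critical_fun (a : R) : R :=
  (2 * PI + a) * cot a - ln ((2 * PI + a) / sin a).

Lemma sin_pos_half (a : R) : 0 < a <= PI / 2 -> 0 < sin a.
Proof. intros. apply sin_gt_0; lra. Qed.

Lemma critical_fun_is_derive (a : R) : 0 < a <= PI / 2 ->
  is_derive critical_fun a
    ((2 * (sin a * cos a) - (2 * PI + a)) / (sin a * sin a) - 1 / (2 * PI + a)).
Proof.
  intros Ha. pose proof (sin_pos_half a Ha) as Hs. pose proof PI_RGT_0.
  unfold critical_fun, cot. auto_derive.
  - repeat split; try lra. apply Rdiv_lt_0_compat; lra.
  - pose proof (sin2_cos2 a) as E. unfold Rsqr in E.
    assert (E' : cos a * cos a = 1 - sin a * sin a) by lra.
    field_simplify_eq; [| split; lra].
    replace (cos a ^ 2) with (1 - sin a ^ 2) by (simpl; lra). ring.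
Qed.

Lemma critical_fun_decreasing (a b : R) :
  0 < a -> a < b -> b <= PI / 2 -> critical_fun b < critical_fun a.
Proof.
  intros Ha Hab Hb. pose proof PI2_1 as P1.
  destruct (MVT_gen critical_fun a b
    (fun a => (2 * (sin a * cos a) - (2 * PI + a)) / (sin a * sin a)
              - 1 / (2 * PI + a))) as [x [Hx Heq]];
    rewrite ?Rmin_left, ?Rmax_right in * by lra.
  - intros x Hx. apply critical_fun_is_derive. lra.
  - intros x Hx. apply continuity_pt_filterlim, continuous_of_ex_derive.
    eexists. apply critical_fun_is_derive. lra.
  - assert (Hs : 0 < sin x) by (apply sin_pos_half; lra).
    (* The numerator is negative as [2 sin x cos x <= 1 < 2 PI]. *)
    assert (N : (2 * (sin x * cos x) - (2 * PI + x)) / (sin x * sin x) < 0).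
    { apply Rdiv_neg_pos; [| now apply Rmult_lt_0_compat].
      pose proof (sin2_cos2 x) as E. unfold Rsqr in E.
      pose proof (Rle_0_sqr (sin x - cos x)) as Q. unfold Rsqr in Q. lra. }
    assert (0 < 1 / (2 * PI + x)) by (apply Rdiv_lt_0_compat; lra).
    assert (0 < (b - a) * - ((2 * (sin x * cos x) - (2 * PI + x)) / (sin x * sin x)
                   - 1 / (2 * PI + x))) by (apply Rmult_lt_0_compat; lra).
    lra.
Qed.

Lemma exp_ge_square (x : R) : 0 <= x -> (1 + x / 2) * (1 + x / 2) <= exp x.
Proof.
  intros Hx. replace x with (x / 2 + x / 2) at 3 by field. rewrite exp_plus.
  pose proof (exp_ineq1_le (x / 2)). apply Rmult_le_compat; lra.
Qed.

Lemma cos_PI4_eq_sin : cos (PI / 4) = sin (PI / 4).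
Proof. now rewrite sin_PI4, cos_PI4. Qed.

(** The logarithm is below [T - 1], where [T] is the value [9 PI / 4] of
    [2 PI + a], because [sin (PI / 4) > 1 / 2] and
    [2 * T < (1 + (T - 1) / 2) ^ 2 <= exp (T - 1)]. *)
Lemma critical_fun_PI4 : 1 < critical_fun (PI / 4).
Proof.
  pose proof PI2_1 as P1. pose proof PI2_3_2 as P2.
  unfold critical_fun, cot.
  assert (Hs : 0 < sin (PI / 4)) by (apply sin_pos_half; lra).
  replace (cos (PI / 4) / sin (PI / 4)) with 1
    by (rewrite cos_PI4_eq_sin; field; lra).
  set (T := 2 * PI + PI / 4). rewrite Rmult_1_r.
  assert (HT : 6 < T) by (unfold T; lra).
  assert (Hlow : / 2 < sin (PI / 4)).
  { pose proof (sin2_cos2 (PI / 4)) as E. unfold Rsqr in E.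
    rewrite cos_PI4_eq_sin in E. nra. }
  assert (Hln : ln (T / sin (PI / 4)) < T - 1).
  { rewrite <- (ln_exp (T - 1)). apply ln_increasing.
    - apply Rdiv_lt_0_compat; lra.
    - apply Rlt_trans with (2 * T).
      + apply Rmult_lt_reg_r with (sin (PI / 4)); [lra |].
        replace (T / sin (PI / 4) * sin (PI / 4)) with T by (field; lra). nra.
      + pose proof (exp_ge_square (T - 1)). nra. }
  lra.
Qed.

Lemma critical_fun_PI2 : critical_fun (PI / 2) < 1.
Proof.
  pose proof PI2_1 as P1. unfold critical_fun, cot.
  rewrite cos_PI2, sin_PI2.
  assert (0 < ln ((2 * PI + PI / 2) / 1)).
  { rewrite <- ln_1. apply ln_increasing; lra. }
  lra.
Qed.

Lemma critical_angle_exists : exists a, is_critical_angle a.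
Proof.
  pose proof PI2_1 as P1.
  pose proof critical_fun_PI4 as F4. pose proof critical_fun_PI2 as F2.
  destruct (IVT_interv (fun a => 1 - critical_fun a) (PI / 4) (PI / 2))
    as [a [Ha E]]; try lra.
  - intros a Ha.
    apply continuity_pt_minus; [apply continuity_pt_const; now intros ? ? |].
    apply continuity_pt_filterlim, continuous_of_ex_derive.
    eexists. apply critical_fun_is_derive. lra.
  - exists a. split.
    + destruct (Req_dec a (PI / 2)) as [-> |]; lra.
    + unfold critical_fun in E. lra.
Qed.

(** * Growth of the datum over one turn *)

(** The exponential form of [critical_fun a >= 1], which is how the size of the
    delayed coefficient enters. *)
Lemma delay_rate_bound (a : R) : 0 < a < PI / 2 -> 1 <= critical_fun a ->
  (2 * PI + a) / sin a * exp 1 <= exp ((2 * PI + a) * cot a).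
Proof.
  intros Ha HF. pose proof (sin_pos_half a ltac:(lra)) as Hs.
  assert (HT : 0 < (2 * PI + a) / sin a) by (apply Rdiv_lt_0_compat; lra).
  rewrite <- (exp_ln _ HT), <- exp_plus.
  unfold critical_fun in HF.
  destruct (Req_dec (ln ((2 * PI + a) / sin a) + 1) ((2 * PI + a) * cot a)) as [E | E].
  - rewrite E. apply Rle_refl.
  - left. apply exp_increasing. lra.
Qed.

(** With [cot a >= 1 / a - a / 2] and [cot a >= 1], the bound
    [exp x >= 1 + x + (x / 2) ^ 2] at [x = 2 PI cot a] gives at least
    [1 + 2 PI / a - PI a + PI ^ 2], and [PI ^ 2 - PI a >= 1]. *)
Lemma turn_growth_small (a : R) : 0 < a <= PI / 4 ->
  2 + 2 * PI / a <= exp (2 * PI * cot a).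
Proof.
  intros Ha. pose proof PI2_1 as P1. pose proof PI_4 as P4.
  pose proof (sin_pos_half a ltac:(lra)) as Hs.
  assert (C1 : 1 <= cot a).
  { assert (cos (PI / 4) <= cos a) by (apply cos_decr_1; lra).
    assert (sin a <= sin (PI / 4)) by (apply sin_incr_1; lra).
    pose proof cos_PI4_eq_sin.
    unfold cot. apply Rle_div_r; lra. }
  assert (C2 : 1 / a - a / 2 <= cot a).
  { assert (H2 : 0 < sin (a / 2)) by (apply sin_pos_half; lra).
    pose proof (sin_lt_x (a / 2) ltac:(lra)). pose proof (sin_lt_x a ltac:(lra)).
    assert (cos a = 1 - 2 * sin (a / 2) * sin (a / 2))
      by (rewrite <- cos_2a_sin; f_equal; field).
    assert (sin (a / 2) * sin (a / 2) <= a / 2 * (a / 2))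
      by (apply Rmult_le_compat; lra).
    unfold cot. apply Rle_div_r; [lra |].
    apply Rle_trans with ((1 / a - a / 2) * a).
    - apply Rmult_le_compat_l; [| lra].
      replace (1 / a - a / 2) with ((1 - a * a / 2) / a) by (field; lra).
      apply Rdiv_le_0_compat; [nra | lra].
    - replace ((1 / a - a / 2) * a) with (1 - a * a / 2) by (field; lra). lra. }
  eapply Rle_trans; [| apply exp_ge_square; nra].
  assert (E : 2 * PI * (1 / a - a / 2) = 2 * PI / a - PI * a) by (field; lra).
  assert (2 * PI * (1 / a - a / 2) <= 2 * PI * cot a)
    by (apply Rmult_le_compat_l; lra).
  assert (PI * PI <= PI * cot a * (PI * cot a)) by (apply Rmult_le_compat; nra).
  nra.
Qed.

(** [a * cot a] decreases and equals [PI / 4] at [PI / 4]; cleared of the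
    denominator, it suffices that [PI / 4 * sin x - x * cos x], which vanishes
    at [PI / 4], increases. *)
Lemma mul_cot_le (a : R) : PI / 4 <= a < PI / 2 -> a * cot a <= PI / 4.
Proof.
  intros Ha. pose proof PI2_1 as P1.
  set (g := fun x => PI / 4 * sin x - x * cos x).
  assert (G : g (PI / 4) <= g a).
  { apply nondecreasing_of_right_derive; [lra | |]; intros x Hx.
    - apply continuous_of_ex_derive. unfold g. auto_derive. trivial.
    - exists ((PI / 4 - 1) * cos x + x * sin x). split.
      + assert (cos x <= cos (PI / 4)) by (apply cos_decr_1; lra).
        assert (sin (PI / 4) <= sin x) by (apply sin_incr_1; lra).
        pose proof cos_PI4_eq_sin.
        assert (0 <= cos x) by (apply cos_ge_0; lra).
        nra.
      + apply is_right_derive_of_is_derive. unfold g. auto_derive; [trivial | ring]. }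
  unfold g in G.
  pose proof cos_PI4_eq_sin.
  pose proof (sin_pos_half a ltac:(lra)) as Hs.
  unfold cot. replace (a * (cos a / sin a)) with (a * cos a / sin a) by (field; lra).
  apply Rle_div_l; nra.
Qed.

(** A partial sum of the Leibniz series for [PI / 4].  Its error after [n]
    terms is about [1 / (4 n)], while [PI / 4] is only about [0.0146] below the
    target [4 / 5], so that a long partial sum is needed. *)
Lemma PI_upper_bound : PI <= 16 / 5.
Proof.
  destruct (PI_ineq 9) as [_ H]. simpl in H.
  unfold tg_alt, PI_tg in H. rewrite !INR_IZR_INZ in H. simpl in H. lra.
Qed.

(** The criticality bound gives
    [exp (2 PI cot a) >= (2 PI + a) / sin a * exp (1 - a * cot a)], whose last
    factor is at least [2 - PI / 4]; with [sin a <= a] the claim becomes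
    [a <= 8 - 2 PI], which holds up to [PI / 2] since [PI <= 16 / 5]. *)
Lemma turn_growth_large (a : R) : PI / 4 <= a < PI / 2 -> 1 <= critical_fun a ->
  2 + 2 * PI / a <= exp (2 * PI * cot a).
Proof.
  intros Ha HF. pose proof PI2_1 as P1. pose proof PI_4 as P4.
  pose proof (sin_pos_half a ltac:(lra)) as Hs.
  pose proof (delay_rate_bound a ltac:(lra) HF) as D.
  pose proof (mul_cot_le a Ha) as K.
  assert (E : exp (2 * PI * cot a)
              = exp ((2 * PI + a) * cot a) * exp (- (a * cot a)))
    by (rewrite <- exp_plus; f_equal; ring).
  rewrite E.
  apply Rle_trans with ((2 * PI + a) / sin a * exp 1 * exp (- (a * cot a))).
  2: { apply Rmult_le_compat_r; [left; apply exp_pos | exact D]. }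
  rewrite Rmult_assoc, <- exp_plus.
  pose proof (exp_ineq1_le (1 + - (a * cot a))) as L.
  apply Rle_trans with ((2 * PI + a) / a * (2 - PI / 4)).
  - replace (2 + 2 * PI / a) with ((2 * a + 2 * PI) / a) by (field; lra).
    replace ((2 * PI + a) / a * (2 - PI / 4)) with ((2 * PI + a) * (2 - PI / 4) / a)
      by (field; lra).
    apply Rmult_le_compat_r; [left; apply Rinv_0_lt_compat; lra |].
    pose proof PI_upper_bound.
    assert (0 <= PI / 4 * (8 - 2 * PI - a)) by (apply Rmult_le_pos; lra). lra.
  - apply Rmult_le_compat; [apply Rdiv_le_0_compat; lra | lra | | lra].
    apply Rmult_le_compat_l; [lra |]. apply Rinv_le_contravar; [lra |].
    left. apply sin_lt_x. lra.
Qed.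

(** Bounding [exp (a / T)] below by [1 + a / T], where [T = 2 PI + a], turns the
    claim into [exp (2 PI cot a) >= 2 + 2 PI / a]. *)
Lemma initial_jump_bound (a : R) : 0 < a < PI / 2 -> 1 <= critical_fun a ->
  exp (- (a / (2 * PI + a))) <= 1 - exp (- (2 * PI * cot a)).
Proof.
  intros Ha HF. pose proof PI2_1 as P1.
  assert (G : 2 + 2 * PI / a <= exp (2 * PI * cot a)).
  { destruct (Rle_lt_dec a (PI / 4));
      [apply turn_growth_small | apply turn_growth_large]; lra. }
  pose proof (exp_ineq1_le (a / (2 * PI + a))) as L.
  assert (0 < 2 * PI / a) by (apply Rdiv_lt_0_compat; lra).
  assert (0 < a / (2 * PI + a)) by (apply Rdiv_lt_0_compat; lra).
  rewrite !exp_Ropp.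
  apply Rinv_le_contravar in L; [| lra]. apply Rinv_le_contravar in G; [| lra].
  replace (/ (2 + 2 * PI / a)) with (1 - / (1 + a / (2 * PI + a))) in G
    by (field; repeat split; lra).
  lra.
Qed.

(** * Positivity of the ray length *)

Lemma r_sat_positive (a : R) (r : R -> R) :
  0 < a < PI / 2 -> 1 <= critical_fun a -> is_r_sat a r ->
  forall phi, 0 <= phi -> 0 < r phi.
Proof.
  intros Ha HF [Hi1 Hi2 Hc He]. pose proof PI2_1 as P1.
  pose proof (sin_pos_half a ltac:(lra)) as Hs.
  pose proof (delay_rate_bound a Ha HF) as D.
  pose proof (initial_jump_bound a Ha HF) as J.
  set (T := 2 * PI + a) in *. set (c := cot a) in *.
  assert (HT : 0 < T) by (unfold T; lra).
  set (w := fun x => r x * exp ((/ T - c) * x)).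
  assert (Hw : forall x, 0 <= x -> 0 < w x).
  { apply (delay_positive T (/ T) (/ sin a * exp ((/ T - c) * T))); trivial.
    - split.
      { apply Rmult_le_pos; left; [now apply Rinv_0_lt_compat | apply exp_pos]. }
      replace ((/ T - c) * T) with (1 + - (T * c)) by (field; lra).
      rewrite exp_plus, exp_Ropp.
      pose proof (exp_pos (T * c)) as Hexp.
      apply Rmult_le_reg_r with (T * exp (T * c)); [now apply Rmult_lt_0_compat |].
      replace (/ T * (T * exp (T * c))) with (exp (T * c)) by (field; lra).
      replace (/ sin a * (exp 1 * / exp (T * c)) * (T * exp (T * c)))
        with (T / sin a * exp 1) by (field; split; lra).
      exact D.
    - intros x Hx. apply (continuous_mult r (fun x => exp ((/ T - c) * x))).
      + now apply Hc.
      + apply continuous_of_ex_derive. auto_derive. trivial.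
    - intros x Hx.
      replace (/ T * w x - / sin a * exp ((/ T - c) * T) * w (x - T))
        with ((c * r x - r (x - T) / sin a) * exp ((/ T - c) * x)
              + r x * ((/ T - c) * exp ((/ T - c) * x))).
      + apply (is_right_derive_mult r (fun x => exp ((/ T - c) * x))).
        * now apply He.
        * auto_derive; [trivial | ring].
      + unfold w. replace ((/ T - c) * x) with ((/ T - c) * T + (/ T - c) * (x - T)) by ring.
        rewrite exp_plus. field. lra.
    - (* On [[0, T]], [w] is [exp (x / T)] before the jump and [m * exp (x / T)]
         after it. *)
      set (m := 1 - exp (- (2 * PI * c))) in *.
      assert (Hm : 0 < m) by (eapply Rlt_le_trans; [apply exp_pos | exact J]).
      assert (W2 : forall x, 2 * PI <= x <= T -> w x = m * exp (x / T)).
      { intros x Hx. unfold w. rewrite (Hi2 x Hx).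
        replace (exp (2 * PI * c) - 1) with (m * exp (2 * PI * c)).
        - rewrite !Rmult_assoc, <- !exp_plus. do 2 f_equal. field. lra.
        - unfold m. rewrite Rmult_minus_distr_r, <- exp_plus, Rplus_opp_l, exp_0. ring. }
      assert (WT : w T = m * exp 1).
      { rewrite W2; [| unfold T; lra]. do 2 f_equal. field. lra. }
      intros x Hx. rewrite WT. destruct (Rlt_le_dec x (2 * PI)) as [Hx2 | Hx2].
      + assert (W1 : w x = exp (x / T)).
        { unfold w. rewrite Hi1 by lra. rewrite <- exp_plus. f_equal. field. lra. }
        rewrite W1. split; [apply exp_pos |].
        apply Rle_trans with (exp (- (a / T)) * exp 1).
        * rewrite <- exp_plus. left. apply exp_increasing.
          replace (- (a / T) + 1) with (2 * PI / T) by (unfold T; field; lra).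
          apply Rmult_lt_compat_r; [now apply Rinv_0_lt_compat | lra].
        * apply Rmult_le_compat_r; [left; apply exp_pos | exact J].
      + rewrite W2 by lra. split; [apply Rmult_lt_0_compat; [lra | apply exp_pos] |].
        apply Rmult_le_compat_l; [lra |].
        assert (x / T <= 1) by (apply Rle_div_l; lra).
        destruct (Req_dec (x / T) 1) as [-> |]; [lra |].
        left. apply exp_increasing. lra. }
  intros x Hx. specialize (Hw x Hx). unfold w in Hw.
  pose proof (exp_pos ((/ T - c) * x)). nra.
Qed.

Theorem proposition1p16 :
  exists alpha_bar : R,
    unique is_critical_angle alpha_bar /\
    forall (sigma : R) (r_sat : R -> R),
      1 < sigma <= 1 / cos alpha_bar ->
      is_r_sat (acos (1 / sigma)) r_sat ->
      forall phi : R, 0 <= phi -> 0 < r_sat phi.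
Proof.
  pose proof PI2_1 as P1.
  destruct critical_angle_exists as [a0 [Ha0 E0]].
  exists a0. split.
  - split; [now split |]. intros a [Ha E].
    destruct (Rtotal_order a0 a) as [H | [H | H]]; trivial;
      apply critical_fun_decreasing in H; unfold critical_fun in H; lra.
  - intros sigma r [Hs1 Hs2] Hr.
    assert (C0 : 0 < cos a0) by (apply cos_gt_0; lra).
    assert (B1 : 0 < 1 / sigma) by (apply Rdiv_lt_0_compat; lra).
    assert (B2 : 1 / sigma < 1) by (apply Rlt_div_l; lra).
    assert (B3 : cos a0 <= 1 / sigma).
    { apply Rle_div_r; [lra |]. apply Rle_div_r in Hs2; lra. }
    set (a := acos (1 / sigma)) in *.
    assert (Ca : cos a = 1 / sigma) by (apply cos_acos; lra).
    pose proof (acos_bound (1 / sigma)) as Hb. fold a in Hb.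
    assert (Ha : 0 < a).
    { destruct Hb as [[Hb | Hb] _]; trivial. rewrite <- Hb, cos_0 in Ca. lra. }
    assert (Haa : a <= a0).
    { apply cos_decr_0; lra. }
    apply r_sat_positive with a; trivial; [lra |].
    destruct Haa as [H | ->]; [| unfold critical_fun; lra].
    apply critical_fun_decreasing in H; try lra. unfold critical_fun in *. lra.
Qed.
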